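(* For every $n\ge1$, the pairs $(\mathrm{LAC},\mathrm{imaj})$ and $(\mathrm{LAC},\mathrm{inv})$ are equidistributed on $\mathfrak S_n$: for every word $L$ and every integer $m$, $$\#\{\sigma\in\mathfrak S_n:\mathrm{LAC}\,\sigma=L,\ \mathrm{imaj}\,\sigma=m\}=\#\{\sigma\in\mathfrak S_n:\mathrm{LAC}\,\sigma=L,\ \mathrm{inv}\,\sigma=m\}.$$
   Context: For $\sigma\in\mathfrak S_n$: $\mathrm{maj}\,\sigma=\sum i$ over $1\le i\le n-1$ with $\sigma(i)>\sigma(i+1)$; $\mathrm{imaj}\,\sigma=\mathrm{maj}\,\sigma^{-1}$; $\mathrm{inv}\,\sigma$ is the number of pairs $a<b$ with $\sigma(a)>\sigma(b)$. With the convention $\sigma(n+1)=+\infty$, for each $1\le i\le n$ set $\ell_i=0$ if $\sigma(i)<\sigma(i+1)$, and $\ell_i=k$ if $\sigma(i)$ is greater than all of $\sigma(i+1),\dots,\sigma(i+k)$ but $\sigma(i)<\sigma(i+k+1)$; $\mathrm{LAC}\,\sigma=\ell_1\cdots\ell_n$. *)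

(* Defs.v *)
From mathcomp Require Import all_boot all_order all_fingroup all_algebra.

Set Implicit Arguments.
Unset Strict Implicit.
Unset Printing Implicit Defensive.

(* One-line notation with positions and values both counted from 1: for
   1 <= i <= n, [pw s i] is sigma(i) in {1, ..., n}; positions beyond n get
   n.+1, which exceeds every value and so encodes sigma(n+1) = +oo.
   The junk position 0 is never used below. *)
Definition pw (n : nat) (s : 'S_n) (i : nat) : nat :=
  if insub i.-1 is Some j then (s (j : 'I_n)).+1 else n.+1.

Definition maj (n : nat) (s : 'S_n) : nat :=
  \sum_(1 <= i < n | pw s i > pw s i.+1) i.

Definition imaj (n : nat) (s : 'S_n) : nat := maj (s^-1)%g.

Definition inv_count (n : nat) (s : 'S_n) : nat :=
  #|[set p : 'I_n * 'I_n | (p.1 < p.2) && (s p.1 > s p.2)]|.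

(* The case k = 0 reads sigma(i) < sigma(i+1), the first conjunct being vacuous. *)
Definition is_lac (n : nat) (s : 'S_n) (i k : nat) : bool :=
  [forall j : 'I_k, pw s i > pw s (i + j.+1)] && (pw s i < pw s (i + k.+1)).

(* The k < n such that [is_lac s i k], which exists and is unique: see [lacP]. *)
Definition lac (n : nat) (s : 'S_n) (i : nat) : nat :=
  find (is_lac s i) (iota 0 n).

Definition LAC (n : nat) (s : 'S_n) : seq nat := [seq lac s i | i <- iota 1 n].

Lemma is_lac_uniq (n : nat) (s : 'S_n) (i k k' : nat) :
  is_lac s i k -> is_lac s i k' -> k = k'.
Proof.
move=> /andP[/forallP Ak Bk] /andP[/forallP Ak' Bk'].
case: (ltngtP k k') => // lt_kk'.
  by have := Ak' (Ordinal lt_kk'); rewrite /= ltnNge (ltnW Bk).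
by have := Ak (Ordinal lt_kk'); rewrite /= ltnNge (ltnW Bk').
Qed.

Lemma is_lac_ex (n : nat) (s : 'S_n) (i : nat) :
  0 < i <= n -> exists2 k, k < n & is_lac s i k.
Proof.
case: i => // i /= lt_in.
have pwi : pw s i.+1 = (s (Ordinal lt_in)).+1 by rewrite /pw /= insubT.
have pw_last : pw s i.+1 < pw s (i.+1 + (n - i.+1).+1).
  rewrite pwi addnS subnKC // /pw /= insubF ?ltnn //.
  by rewrite ltnS ltn_ord.
have exP : exists k, pw s i.+1 < pw s (i.+1 + k.+1) by exists (n - i.+1).
case: (ex_minnP exP) => k Pk mink.
have le_k : k <= n - i.+1 by apply: mink.
exists k; first by apply: leq_ltn_trans le_k _; rewrite ltn_subrL (leq_ltn_trans _ lt_in).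
rewrite /is_lac Pk andbT; apply/forallP => j.
have : ~~ (pw s i.+1 < pw s (i.+1 + j.+1)).
  by apply/negP => /mink; rewrite leqNgt ltn_ord.
rewrite -leqNgt leq_eqVlt => /orP[/eqP|//].
have lt_ij : i + j.+1 < n.
  have := leq_trans (ltn_ord j) le_k.
  by rewrite ltn_subRL addSn addnS.
rewrite pwi /pw /= insubT => -[] /val_inj /perm_inj [] /eqP.
by rewrite -[X in _ == X]addn0 eqn_add2l.
Qed.

Lemma lacP (n : nat) (s : 'S_n) (i k : nat) :
  0 < i <= n -> (lac s i == k) = is_lac s i k.
Proof.
move=> /(is_lac_ex s)[k0 lt_k0 Pk0].
have hasP0 : has (is_lac s i) (iota 0 n).
  by apply/hasP; exists k0; rewrite ?mem_iota.
have Plac : is_lac s i (lac s i).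
  have := nth_find 0 hasP0; rewrite nth_iota ?add0n //.
  by move: hasP0; rewrite has_find size_iota.
by apply/eqP/idP => [<- //|]; apply: is_lac_uniq.
Qed.

(* Main.v *)
(** Work with the word of [s^-1]. Foata's second fundamental transformation
    turns [maj] into [inv].  Each of its steps moves letters smaller than [x]
    past letters larger than [x] in a word followed by [x]; hence for every
    interval of values [[i, j]] the last letter of the word lying in [[i, j]]
    does not change.  These last letters determine LAC of the inverse
    permutation: [l_i >= k] iff, among the letters [i, ..., i + k], the letter
    [i] occurs last. *)

Require Import Defs.
From mathcomp Require Import all_boot all_order all_fingroup all_algebra.
From mathcomp Require Import zify.

Set Implicit Arguments.
Unset Strict Implicit.
Unset Printing Implicit Defensive.

(** * Rotating the factors of a word *)

(* Cutting the word after each letter satisfying [p], moves the last letter of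
   each factor to the front of this factor. *)
Fixpoint rotate (p : pred nat) (u : seq nat) : seq nat :=
  if u is y :: u' then
    if p y then y :: rotate p u'
    else if rotate p u' is h :: t then [:: h, y & t] else [:: y]
  else [::].

(** Inverse of [rotate] on words whose last letter satisfies [p]. After rotation a letter satisfying
    [p] opens each factor; [z] holds the current one back until the next such letter, or the end,
    closes its factor. *)
Fixpoint unrotate (p : pred nat) (z : nat) (t : seq nat) : seq nat :=
  if t is y :: t' then
    if p y then z :: unrotate p y t' else y :: unrotate p z t'
  else [:: z].

Lemma perm_rotate p u : perm_eq (rotate p u) u.
Proof.
elim: u => //= y u IHu; case: ifP => _; first by rewrite perm_cons.
case: (rotate p u) IHu => [|h t] IHu; first by rewrite perm_cons.
move: IHu; rewrite -(perm_cons y); apply: perm_trans.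
by apply/seq.permP => a /=; lia.
Qed.

Lemma rotate_nilp p u : (rotate p u == [::]) = (u == [::]).
Proof. by rewrite -!size_eq0 (perm_size (perm_rotate p u)). Qed.

Lemma head_rotate (p : pred nat) d u : u != [::] -> p (last d u) -> p (head d (rotate p u)).
Proof.
elim: u => // y [|y' u] IHu _ /=; first by case: ifP.
move=> /(IHu isT); case: ifP => // _ /=; case: ifP => //= _.
by case: (rotate p u).
Qed.

Lemma rotateK (p : pred nat) d u : u != [::] -> p (last d u) ->
  unrotate p (head d (rotate p u)) (behead (rotate p u)) = u.
Proof.
elim: u => // y u IHu _; case: (eqVneq u [::]) => [-> /= -> //|u0 plast].
have {}plast : p (last d u) by case: u u0 plast {IHu}.
have := head_rotate u0 plast; have := IHu u0 plast.
have := u0; rewrite -(rotate_nilp p) /=.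
case: (rotate p u) => //= h t _ eq_u ph.
by case: ifP => py /=; rewrite ?ph ?py eq_u.
Qed.

(** A moved letter passes only letters failing [p], so the letters satisfying [p] keep their
    relative order. *)
Lemma filter_rotate_sub (p P : pred nat) u :
  subpred P p -> filter P (rotate p u) = filter P u.
Proof.
move=> sPp; elim: u => //= y u <-; case: ifP => // py.
have nPy : P y = false by apply/negP => /sPp; rewrite py.
rewrite nPy.
by case: (rotate p u) => [|h t] /=; rewrite nPy.
Qed.

(** If the last letter satisfies [p], so does every moved letter; the letters failing [p] then keep
    their relative order. *)
Lemma filter_rotate_subC (p P : pred nat) d u :
  subpred P (predC p) -> u != [::] -> p (last d u) ->
  filter P (rotate p u) = filter P u.
Proof.
move=> sPp; elim: u => // y u IHu _.
case: (eqVneq u [::]) => [-> /= -> //|u0 plast].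
have {}plast : p (last d u) by case: u u0 plast {IHu}.
have := head_rotate u0 plast; rewrite /= -(IHu u0 plast); case: ifP => // _.
case: (rotate p u) => //= h t ph.
by have /negbTE -> : ~~ P h by apply/negP => /sPp /=; rewrite ph.
Qed.

(** * Effect of rotation on inversions *)

Fixpoint inv_seq (u : seq nat) : nat :=
  if u is y :: u' then count (ltn^~ y) u' + inv_seq u' else 0.

Lemma inv_seq_rcons u x : inv_seq (rcons u x) = inv_seq u + count (ltn x) u.
Proof. by elim: u => //= y u ->; rewrite -cats1 count_cat /=; lia. Qed.

(** Each letter failing [p] is passed exactly once, by the smaller letter that ends its factor,
    which destroys one inversion. *)
Lemma inv_rotate_lt (p : pred nat) d u :
    (forall a b, p a -> ~~ p b -> a < b) -> u != [::] -> p (last d u) ->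
  inv_seq (rotate p u) + count (predC p) u = inv_seq u.
Proof.
move=> ltp; elim: u => // y u IHu _.
case: (eqVneq u [::]) => [-> /= -> //|u0 plast].
have {}plast : p (last d u) by case: u u0 plast {IHu}.
have := head_rotate u0 plast; rewrite /= -(IHu u0 plast).
rewrite -!(seq.permP (perm_rotate p u) (ltn^~ y)).
have := u0; rewrite -(rotate_nilp p) /=.
case: ifP => py /=; first by lia.
case: (rotate p u) => //= h t _ ph.
by have := ltp _ _ ph (negbT py); lia.
Qed.

Lemma inv_rotate_gt (p : pred nat) d u :
    (forall a b, p a -> ~~ p b -> b < a) -> u != [::] -> p (last d u) ->
  inv_seq (rotate p u) = inv_seq u + count (predC p) u.
Proof.
move=> ltp; elim: u => // y u IHu _.
case: (eqVneq u [::]) => [-> /= -> //|u0 plast].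
have {}plast : p (last d u) by case: u u0 plast {IHu}.
have := head_rotate u0 plast; have := IHu u0 plast.
rewrite /= -!(seq.permP (perm_rotate p u) (ltn^~ y)).
have := u0; rewrite -(rotate_nilp p) /=.
case: ifP => py /=; first by lia.
case: (rotate p u) => //= h t _ + ph.
by have := ltp _ _ ph (negbT py); lia.
Qed.

(** * Foata's transformation and its injectivity *)

(** For [y != x], the side of [x] on which [y] lies. Taking for [y] the last letter of the word
    makes the last factor end in a letter satisfying the predicate. *)
Definition foata_pred (x y : nat) : pred nat :=
  if y < x then ltn^~ x else ltn x.

Definition foata_step (u : seq nat) (x : nat) : seq nat :=
  rcons (rotate (foata_pred x (last 0 u)) u) x.

Definition foata (w : seq nat) : seq nat := foldl foata_step [::] w.

Lemma foata_rcons w x : foata (rcons w x) = foata_step (foata w) x.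
Proof. by rewrite /foata foldl_rcons. Qed.

Lemma perm_foata w : perm_eq (foata w) w.
Proof.
elim/last_ind: w => // w x IHw; rewrite foata_rcons perm_rcons perm_sym perm_rcons.
by rewrite perm_cons perm_sym (perm_trans (perm_rotate _ _) IHw).
Qed.

Lemma last_foata d w : last d (foata w) = last d w.
Proof. by case/lastP: w => // w x; rewrite foata_rcons !last_rcons. Qed.

Lemma foata_pred_self x y : x != y -> foata_pred x y y.
Proof. by rewrite /foata_pred; case: ifP => //=; lia. Qed.

Lemma foata_pred_eq x y z : foata_pred x y z -> foata_pred x z = foata_pred x y.
Proof.
by rewrite /foata_pred; case: (ltnP y x) => _ /= => [-> //|/ltnW]; rewrite ltnNge => ->.
Qed.

Lemma foata_pred_last x (u : seq nat) : x \notin u -> u != [::] ->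
  foata_pred x (last 0 u) (last 0 u).
Proof.
by case: u => // y u xu _; apply/foata_pred_self/(memPnC xu)/mem_last.
Qed.

(** The first letter of the rotated word lies on the same side of [x] as the last letter of [u]. The
    predicate is thus readable from the output, and [unrotate] recovers [u]. *)
Lemma foata_step_inj (u u' : seq nat) x x' : x \notin u -> x' \notin u' ->
  foata_step u x = foata_step u' x' -> u = u' /\ x = x'.
Proof.
move=> xu xu' /rcons_inj[eq_uu' eq_xx']; move: xu' eq_uu'; rewrite -{}eq_xx' => xu' eq_uu'.
split=> //; have := rotate_nilp (foata_pred x (last 0 u)) u.
rewrite eq_uu' rotate_nilp.
case: (eqVneq u' [::]) => [-> /esym/eqP -> //|u'0 /esym/negbT u0].
have pu := foata_pred_last xu u0; have pu' := foata_pred_last xu' u'0.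
have := foata_pred_eq (head_rotate u'0 pu').
rewrite -eq_uu' (foata_pred_eq (head_rotate u0 pu)) => eq_p.
by rewrite -(rotateK u0 pu) eq_uu' eq_p (rotateK u'0 pu').
Qed.

Lemma foata_inj w w' : uniq w -> uniq w' -> foata w = foata w' -> w = w'.
Proof.
elim/last_ind: w w' => [|w x IHw] w'.
  by move=> _ _ /(congr1 size); rewrite [in RHS](perm_size (perm_foata _)); case: w'.
case/lastP: w' => [|w' x'].
  by move=> _ _ /(congr1 size); rewrite (perm_size (perm_foata _)) size_rcons.
rewrite !rcons_uniq => /andP[xw uw] /andP[xw' uw']; rewrite !foata_rcons.
case/foata_step_inj; rewrite ?(perm_mem (perm_foata _)) // => + ->.
by move/(IHw _ uw uw') => ->.
Qed.

(** An interval containing the new letter [x] has [x] as its last letter, before and after. Any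
    other interval lies on one side of [x], and the rotation preserves the order of the letters on
    each side. *)
Lemma last_filter_foata w d i j : uniq w ->
  last d [seq y <- foata w | i <= y <= j] = last d [seq y <- w | i <= y <= j].
Proof.
elim/last_ind: w => // w x IHw; rewrite rcons_uniq => /andP[xw /IHw {}IHw].
rewrite foata_rcons /foata_step !filter_rcons.
case: ifP => [_|xij]; rewrite ?last_rcons // -{}IHw; congr last.
have {}xw : x \notin foata w by rewrite (perm_mem (perm_foata _)).
case: (eqVneq (foata w) [::]) => [-> //|u0].
have plast := foata_pred_last xw u0.
move: plast; rewrite /foata_pred; case: ifP => _ plast.
- have [lt_jx|] := ltnP j x; first by apply: filter_rotate_sub => y /=; lia.
  by move=> le_xj; apply: filter_rotate_subC plast => // y /=; lia.
- have [lt_jx|] := ltnP j x.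
    by apply: filter_rotate_subC plast => // y /=; lia.
  by move=> le_xj; apply: filter_rotate_sub => y /=; lia.
Qed.

(** * From the major index to inversions *)

Definition maj_seq (w : seq nat) : nat :=
  \sum_(1 <= i < size w | nth 0 w i < nth 0 w i.-1) i.

Lemma maj_seq_rcons w x :
  maj_seq (rcons w x) = maj_seq w + (x < last x w) * size w.
Proof.
case: (eqVneq w [::]) => [->|w0]; first by rewrite /maj_seq /= !big_geq //; lia.
have lt0w : 0 < size w by rewrite lt0n size_eq0.
rewrite /maj_seq size_rcons big_mkcond big_nat_recr //= -big_mkcond; congr (_ + _).
  rewrite [RHS]big_mkcond [LHS]big_mkcond; apply: eq_big_nat => i /andP[_ lt_iw].
  by rewrite !nth_rcons lt_iw (leq_ltn_trans (leq_pred i) lt_iw).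
rewrite !nth_rcons ltnn eqxx ltn_predL lt0w nth_last.
by rewrite (_ : last x w = last 0 w); [case: ifP; lia | case: w w0 {lt0w}].
Qed.

(** Appending [x] creates one inversion per letter above [x]. If the last letter is below [x], the
    rotation destroys as many; otherwise it adds one per letter below [x], for a total of [size w],
    the weight of the new descent. *)
Lemma inv_foata w : uniq w -> inv_seq (foata w) = maj_seq w.
Proof.
elim/last_ind: w => [|w x IHw]; first by rewrite /maj_seq big_geq.
rewrite rcons_uniq => /andP[xw uw].
rewrite foata_rcons inv_seq_rcons maj_seq_rcons -IHw // -(last_foata x).
rewrite -(perm_size (perm_foata w)) (seq.permP (perm_rotate _ _)).
have {}xw : x \notin foata w by rewrite (perm_mem (perm_foata _)).
move: (foata w) xw => u xu.
case: (eqVneq u [::]) => [-> //=|u0]; first by rewrite muln0.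
have plast := foata_pred_last xu u0.
have -> : last x u = last 0 u by case: u u0 {xu plast}.
move: plast; rewrite /foata_pred; case: ifP => ltx plast.
  rewrite ltnNge (ltnW ltx) addn0 -(@inv_rotate_lt (ltn^~ x) 0 u _ u0 plast) => [|a b /=]; last by lia.
  (* Not being below [x] means being above it, as [x] does not occur in [u]. *)
  congr (_ + _); apply: eq_in_count => y yu /=.
  by have := memPnC xu y yu; lia.
rewrite (@inv_rotate_gt (ltn x) 0 u _ u0 plast) => [|a b /=]; last by lia.
by rewrite [x < _]plast mul1n -(count_predC (ltn x) u) -addnA [count (predC _) _ + _]addnC.
Qed.

(** * Permutations and the words of their inverses *)

Lemma last_filter_index (P : pred nat) d w i : uniq w -> i \in w -> P i ->
  (last d (filter P w) == i) = all (fun y => P y ==> (index y w <= index i w)) w.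
Proof.
move=> + + Pi; elim/last_ind: w => // w x IHw; rewrite rcons_uniq => /andP[xw uw].
have idx y : y \in w -> index y (rcons w x) = index y w.
  by move=> yw; rewrite -cats1 index_cat yw.
have idxx : index x (rcons w x) = size w.
  by rewrite -cats1 index_cat (negbTE xw) /= eqxx addn0.
rewrite filter_rcons all_rcons idxx mem_rcons inE.
case: (eqVneq i x) => [eq_ix _|ne_ix /= iw].
  rewrite -{}eq_ix in idx idxx *.
  rewrite Pi last_rcons eqxx idxx leqnn; apply/esym/allP => y yw.
  by rewrite idx // index_size implybT.
rewrite (idx i iw) [size w <= _]leqNgt index_mem iw implybF.
case: ifP => Px /=; first by rewrite last_rcons eq_sym (negbTE ne_ix).
by rewrite IHw //; apply: eq_in_all => y yw; rewrite idx.
Qed.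

Section PermWord.

Variable n : nat.
Implicit Types s t : 'S_n.

Definition perm_word t : n.-tuple nat := [tuple (t i : nat) | i < n].

Lemma nth_perm_word t (i : 'I_n) : nth 0 (perm_word t) i = t i.
Proof. by rewrite -tnth_nth tnth_mktuple. Qed.

Lemma perm_word_uniq t : uniq (perm_word t).
Proof. by rewrite map_inj_uniq ?enum_uniq // => i j /val_inj/perm_inj. Qed.

Lemma perm_word_inj : injective perm_word.
Proof. by move=> t t' eq_tt'; apply/permP => i; apply/val_inj; rewrite /= -!nth_perm_word eq_tt'. Qed.

Lemma index_perm_word s (i : 'I_n) : index (i : nat) (perm_word s^-1) = s i.
Proof.
have <- : nth 0 (perm_word s^-1) (s i) = i by rewrite nth_perm_word permK.
by rewrite index_uniq ?size_tuple ?perm_word_uniq.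
Qed.

Lemma mem_perm_word t i : (i \in tval (perm_word t)) = (i < n).
Proof.
apply/idP/idP => [/mapP[j _ ->]|lt_in]; first exact: ltn_ord.
apply/mapP; exists (t^-1%g (Ordinal lt_in)); first by rewrite mem_enum.
by rewrite permKV.
Qed.

Lemma pw_ord s (i : 'I_n) : pw s i.+1 = (s i).+1.
Proof. by rewrite /pw /= valK. Qed.

Lemma pw_gt s i : n <= i -> pw s i.+1 = n.+1.
Proof. by move=> le_ni; rewrite /pw /= insubF // ltnNge le_ni. Qed.

Lemma maj_perm_word t : maj t = maj_seq (perm_word t).
Proof.
rewrite /maj /maj_seq size_tuple big_mkcond [RHS]big_mkcond.
apply: eq_big_nat => -[//|i] /andP[_ lt_in]; have lt_i'n := ltnW lt_in.
rewrite (nth_perm_word t (Ordinal lt_in)) (nth_perm_word t (Ordinal lt_i'n)).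
by rewrite (pw_ord t (Ordinal lt_in)) (pw_ord t (Ordinal lt_i'n)) ltnS.
Qed.

Lemma inv_seqE w :
  inv_seq w = \sum_(j < size w) \sum_(i < j) (nth 0 w j < nth 0 w i).
Proof.
elim/last_ind: w => [|w x IHw]; first by rewrite big_ord0.
rewrite inv_seq_rcons size_rcons big_ord_recr /= IHw; congr (_ + _).
  apply: eq_bigr => j _; apply: eq_bigr => i _.
  by rewrite !nth_rcons ltn_ord (ltn_trans (ltn_ord i)).
rewrite -sum1_count (big_nth 0) big_mkord big_mkcond; apply: eq_bigr => i _.
by rewrite !nth_rcons ltnn eqxx ltn_ord /=; case: ifP.
Qed.

Lemma inv_perm_word s : inv_count s = inv_seq (perm_word s^-1).
Proof.
pose t := (s^-1)%g.
have -> : inv_count s = #|[set p : 'I_n * 'I_n | (p.1 < p.2) && (t p.1 > t p.2)]|.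
  (* An inversion of [s] at positions [(a, b)] corresponds to the inversion of [t] at positions
     [(s b, s a)]. *)
  pose f (p : 'I_n * 'I_n) := (s p.2, s p.1).
  have f_inj : injective f by move=> [a b] [c d] [] /perm_inj -> /perm_inj ->.
  rewrite -[RHS](card_preimset _ f_inj); apply: eq_card => p.
  by rewrite !inE /= !permK andbC.
have -> : inv_seq (perm_word t) = \sum_(j < n) \sum_(i < n | i < j) (t j < t i).
  rewrite inv_seqE size_tuple; apply: eq_bigr => j _.
  rewrite (big_ord_widen n (fun i => nth 0 (perm_word t) j < nth 0 (perm_word t) i : nat));
    last exact/ltnW.
  by apply: eq_bigr => i _; rewrite !nth_perm_word.
rewrite -sum1dep_card big_mkcond /=.
rewrite -(pair_bigA _ (fun i j : 'I_n => if (i < j) && (t j < t i) then 1 else 0)).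
rewrite exchange_big; apply: eq_bigr => j _; rewrite [RHS]big_mkcond.
by apply: eq_bigr => i _ /=; case: (i < j); case: ltnP.
Qed.

Lemma index_pw s i : i < n -> (index i (perm_word s^-1)).+1 = pw s i.+1.
Proof. by move=> lt_in; rewrite (index_perm_word s (Ordinal lt_in)) -pw_ord. Qed.

(** [pw s i.+1] is one plus the position of the letter [i] in the word of [s^-1], so both sides say
    that [i] comes after [i + 1], ..., [i + k]. *)
Lemma lac_prefixE s i k : i + k < n ->
  [forall j : 'I_k, pw s i.+1 > pw s (i.+1 + j.+1)] =
  (last n [seq y <- perm_word s^-1 | i <= y <= i + k] == i).
Proof.
move=> lt_ik; have lt_in : i < n by lia.
rewrite last_filter_index ?perm_word_uniq ?mem_perm_word ?leqnn ?leq_addr //.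
apply/forallP/allP => [pw_lt y|le_index j].
  rewrite mem_perm_word => lt_yn; apply/implyP => /andP[le_iy le_yik].
  case: (eqVneq y i) => [-> //|ne_yi].
  have lt_jk : y - i.+1 < k by lia.
  have := pw_lt (Ordinal lt_jk); rewrite (_ : _ + _ = y.+1) /=; last by lia.
  by rewrite -!index_pw // ltnS => /ltnW.
have lt_jk := ltn_ord j; have lt_ijn : i + j.+1 < n by lia.
have := le_index (i + j.+1); rewrite mem_perm_word => /(_ lt_ijn).
rewrite (_ : (i <= _ <= _) = true) /=; last by lia.
rewrite addSn -!index_pw // ltnS ltn_neqAle => ->; rewrite andbT.
apply/eqP => /(congr1 (nth 0 (perm_word s^-1))).
by rewrite !nth_index ?mem_perm_word //; lia.
Qed.

Lemma is_lac_lt s i k : i < n -> is_lac s i.+1 k -> i + k < n.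
Proof.
move=> lt_in /andP[/forallP pw_lt _]; rewrite ltnNge; apply/negP => le_n.
(* This index designates position [n.+1], where [pw] takes its infinite value, which [pw s i.+1]
   cannot exceed. *)
have lt_k : n - i.+1 < k by lia.
have := pw_lt (Ordinal lt_k).
rewrite (_ : _ + _ = n.+1) /= ?(pw_gt s (leqnn n)); last by lia.
by rewrite (pw_ord s (Ordinal lt_in)) ltnS ltnNge ltnW.
Qed.

Lemma LAC_last s t :
    (forall i j, last n [seq y <- perm_word s^-1 | i <= y <= j] =
                 last n [seq y <- perm_word t^-1 | i <= y <= j]) ->
  LAC s = LAC t.
Proof.
move=> eq_last; apply/eq_in_map => -[|i]; rewrite mem_iota // => /andP[_ lt_in].
have {}lt_in : i < n by lia.
(* If [k1 < k2], the prefix condition of length [k1.+1] passes from [s2] to [s1] and contradicts the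
   ascent that ends the run of [s1]. *)
have le_lac (s1 s2 : 'S_n) k1 k2 :
    (forall i j, last n [seq y <- perm_word s1^-1 | i <= y <= j] =
                 last n [seq y <- perm_word s2^-1 | i <= y <= j]) ->
  is_lac s1 i.+1 k1 -> is_lac s2 i.+1 k2 -> k2 <= k1.
  move=> eq12 /andP[_ gt_k1] lac2; rewrite leqNgt; apply/negP => lt_k.
  have lt_ik2 := is_lac_lt lt_in lac2.
  have lt_ik1 : i + k1.+1 < n by lia.
  have /forallP/(_ ord_max) : [forall j : 'I_k1.+1, pw s1 i.+1 > pw s1 (i.+1 + j.+1)].
    rewrite lac_prefixE // eq12 -lac_prefixE //; apply/forallP => j.
    by have /andP[/forallP/(_ (widen_ord lt_k j))] := lac2.
  by rewrite /= ltnNge ltnW.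
have lacs : is_lac s i.+1 (lac s i.+1) by rewrite -lacP ?eqxx.
have lact : is_lac t i.+1 (lac t i.+1) by rewrite -lacP ?eqxx.
by apply/eqP; rewrite eqn_leq (le_lac t s _ _ _ lact lacs) ?(le_lac s t _ _ _ lacs lact).
Qed.

(** * Foata's transformation on permutations *)

Lemma foata_perm_ex t : exists t', tval (perm_word t') == foata (perm_word t).
Proof.
have /tuple_permP[p ->] := perm_foata (perm_word t).
exists (p * t)%g; apply/eqP; congr tval; apply: eq_from_tnth => i.
by rewrite !tnth_mktuple permM.
Qed.

Definition foata_perm t : 'S_n := xchoose (foata_perm_ex t).

Lemma perm_word_foata t : tval (perm_word (foata_perm t)) = foata (perm_word t).
Proof. exact/eqP/(xchooseP (foata_perm_ex t)). Qed.

Lemma foata_perm_inj : injective foata_perm.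
Proof.
move=> t t' eq_tt'; apply/perm_word_inj/val_inj/foata_inj; rewrite ?perm_word_uniq //.
by rewrite -!perm_word_foata eq_tt'.
Qed.

End PermWord.

Theorem theorem7p2 (n : nat) (n_ge1 : 1 <= n) (L : seq nat) (m : int) :
  #|[set s : 'S_n | (LAC s == L) && (Posz (imaj s) == m)]| =
  #|[set s : 'S_n | (LAC s == L) && (Posz (inv_count s) == m)]|.
Proof.
(* Since [imaj s] is [maj] of the inverse, Foata's map is conjugated by inversion. [G] preserves
   [LAC] and sends [imaj] to [inv_count], so the left set is the preimage of the right one under
   [G]. *)
pose G (s : 'S_n) := ((foata_perm s^-1)^-1)%g.
have G_inj : injective G by move=> s t /invg_inj/foata_perm_inj/invg_inj.
rewrite -[RHS](card_preimset _ G_inj); apply: eq_card => s; rewrite !inE.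
congr ((_ == L) && (Posz _ == m)).
  by apply: LAC_last => i j; rewrite invgK perm_word_foata last_filter_foata ?perm_word_uniq.
by rewrite inv_perm_word invgK perm_word_foata inv_foata ?perm_word_uniq // -maj_perm_word.
Qed.
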